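(* For each integer $h\ge 1$ there exists a $\mathrm{GDD}(4,5,20\cdot 9h+17\cdot 9h)$ of type $(9h)^{20}(17\cdot 9h)^1$.
   Context: A group divisible design $\mathrm{GDD}(t,k,m)$ of type $g_1^{n_1} g_2^{n_2}\cdots g_r^{n_r}$, where $t \ge 2$ and $m=\sum_{i=1}^r n_i g_i$, is a triple $(X,G,B)$ such that $X$ is a set of $m$ points; $G$ is a partition of $X$ into $n=\sum_{i=1}^r n_i$ groups, of which $n_i$ have exactly $g_i$ points, $1\le i\le r$; $B$ is a set of $k$-subsets of $X$ (blocks); each block contains at most one point from each group; and each $t$-subset of $X$ which contains at most one point from each group is contained in exactly one block of $B$. *)

(* Defs.v *)
From mathcomp Require Import all_boot.

Set Implicit Arguments.
Unset Strict Implicit.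
Unset Printing Implicit Defensive.

Definition transverse (X : finType) (G : {set {set X}}) (S : {set X}) : Prop :=
  forall A : {set X}, A \in G -> #|S :&: A| <= 1.

(* The type g_1^{n_1} ... g_r^{n_r} is encoded as the sequence of pairs
   [:: (g_1, n_1); ...; (g_r, n_r)], the sizes g_i being pairwise distinct. *)
Record is_GDD (t k m : nat) (type : seq (nat * nat))
    (X : finType) (G B : {set {set X}}) : Prop := IsGDD {
  gdd_strength : 2 <= t;
  gdd_sizes_uniq : uniq [seq gn.1 | gn <- type];
  gdd_order : m = \sum_(gn <- type) gn.2 * gn.1;
  gdd_points : #|X| = m;
  gdd_partition : partition G [set: X];
  gdd_num_groups : #|G| = \sum_(gn <- type) gn.2;
  gdd_group_type : forall gn, gn \in type ->
    #|[set A in G | #|A| == gn.1]| = gn.2;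
  gdd_block_size : forall b, b \in B -> #|b| = k;
  gdd_block_transverse : forall b, b \in B -> transverse G b;
  gdd_cover : forall S : {set X}, #|S| = t -> transverse G S ->
    exists! b : {set X}, b \in B /\ S \subset b
}.

Definition GDD_exists (t k m : nat) (type : seq (nat * nat)) : Prop :=
  exists (X : finType) (G B : {set {set X}}), is_GDD t k m type G B.

(* Main.v *)
Require Import Defs.
From mathcomp Require Import all_boot.
From mathcomp Require Import ssralg finalg zmodp.

(** The design comes from a large set of Steiner quadruple systems with
    multiplicity.  Suppose that 153 systems S(3,4,20) on one set [P] of 20
    places are given, and that every 4-subset of [P] is a block of exactly 9 of
    them.  Repeat each system [h] times: this gives a family [Y] of 17 * 9h
    systems in which every 4-subset [Q] of [P] is a block of exactly 9h members.
    Take the groups {v} x Z_9h for [v] in [P], and the family [Y] itself as the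
    large group.  For each [Q] fix a bijection, [color Q], from the members of
    [Y] containing [Q] to Z_9h; the blocks are the sets
      { (v, f v) | v in Q } together with y,   where   color Q y = sum of f on Q.
    A transverse 4-set inside the small groups lies over some [Q] and fixes the
    sum of [f], hence [y], because [color Q] is a bijection.  A transverse 4-set
    that contains [y] lies over a triple of places; the system [y] has exactly
    one block [Q] through this triple, and the value of [f] at the fourth place
    is then the solution of one linear equation in Z_9h.  This argument is
    [GDD_of_multifold_large_set]; it works for Steiner systems S(t,t+1,n) of any
    strength.

    It remains to find the 153 systems.  The places are F_17 together with three
    extra points, on which the group Z_17 x Z_3 acts by translating F_17 and by
    rotating the extra points.  Three base systems, moved by the 51 elements of
    this group, give 153 systems.  Each base system is invariant under x -> 2x on
    F_17, which has order 8, and is therefore listed by about forty starter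
    blocks.  Since doubling normalizes the group of motions, the 153 systems are
    permuted by the group that doubling and the motions generate, and the
    multiplicity of a 4-set depends only on its orbit under that larger group.
    There are 31 orbits; the three base systems were selected, among the many
    systems invariant under doubling, to have together the number of blocks in
    each orbit that makes all multiplicities equal to 9.  That these are Steiner
    systems and that the multiplicities are 9 is checked by computation, the
    latter only for the 4-sets through the origin of F_17, since the motions take
    every 4-set to such a set. *)

Set Implicit Arguments.
Unset Strict Implicit.
Unset Printing Implicit Defensive.

Import GRing.Theory.

(** * Group divisible designs from multifold large sets *)

Definition steiner (t : nat) (P : finType) (B : {set {set P}}) : Prop :=
  (forall Q, Q \in B -> #|Q| = t.+1) /\
  (forall T : {set P}, #|T| = t -> exists! Q, Q \in B /\ T \subset Q).

Section Labelling.

Variables (Y Z : finType) (z0 : Z).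

(** Matching the two enumerations gives a bijection from [A] to [Z] as soon as the
    cardinals agree; being defined on all of [Y], it needs no dependent type. *)
Definition label (A : {set Y}) (y : Y) : Z :=
  nth z0 (enum Z) (index y (enum A)).

Lemma label_bij (A : {set Y}) (z : Z) :
  #|A| = #|Z| -> exists! y, y \in A /\ label A y = z.
Proof.
move=> cardA; have sizeA : size (enum A) = size (enum Z) by rewrite -!cardE.
have zE : z \in enum Z by rewrite mem_enum.
have y0 : Y.
  case: (pickP [in A]) => [y // | A0].
  by move: zE; rewrite -index_mem -sizeA -cardE (eq_card0 A0) ltn0.
have ltzA : index z (enum Z) < size (enum A) by rewrite sizeA index_mem.
exists (nth y0 (enum A) (index z (enum Z))); split.
  split; first by rewrite -mem_enum mem_nth.
  by rewrite /label index_uniq ?enum_uniq // nth_index.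
move=> y [yA <-]; rewrite /label index_uniq ?enum_uniq //.
  by rewrite nth_index ?mem_enum.
by rewrite -sizeA index_mem mem_enum.
Qed.

End Labelling.

Section GroupDivisibleDesign.

Variables (P Y : finType) (Z : finZmodType) (sys : Y -> {set {set P}}).

Local Notation point := (P * Z + Y)%type.

(** Encoding the groups as the fibres of one map turns transversality of a set
    into injectivity of this map on it. *)
Definition group_index (x : point) : option P :=
  match x with inl (v, _) => Some v | inr _ => None end.

Definition group_at (u : option P) : {set point} := [set x | group_index x == u].

Definition groups : {set {set point}} := [set group_at u | u : option P].

(** The part of a block outside the large group: the graph of [f] over [Q]. *)
Definition graph_on (f : {ffun P -> Z}) (Q : {set P}) : {set point} :=
  [set inl (v, f v) | v in Q].

Definition color (Q : {set P}) (y : Y) : Z := label 0%R [set y | Q \in sys y] y.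

Definition blocks : {set {set point}} :=
  [set b | [exists y, exists Q, exists f : {ffun P -> Z},
     [&& Q \in sys y, color Q y == (\sum_(v in Q) f v)%R &
         b == inr y |: graph_on f Q]]].

Lemma blocksP b :
  reflect (exists y Q (f : {ffun P -> Z}),
             [/\ Q \in sys y, color Q y = (\sum_(v in Q) f v)%R &
                 b = inr y |: graph_on f Q])
          (b \in blocks).
Proof.
rewrite inE; apply: (iffP existsP) => [[y /existsP[Q /existsP[f]]] | [y [Q [f]]]].
  by case/and3P=> ? /eqP ? /eqP ?; exists y, Q, f.
case=> QB /eqP col /eqP bE; exists y; apply/existsP; exists Q; apply/existsP.
by exists f; apply/and3P.
Qed.

Lemma mem_graph_inl f Q v z : (inl (v, z) \in graph_on f Q) = (v \in Q) && (z == f v).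
Proof.
apply/imsetP/andP => [[w wQ [-> ->]] | [vQ /eqP->]] //.
by exists v.
Qed.

Lemma mem_graph_inr f Q y : (inr y \in graph_on f Q) = false.
Proof. by apply/imsetP => -[]. Qed.

Lemma card_graph_on f Q : #|graph_on f Q| = #|Q|.
Proof. by rewrite card_imset // => v w []. Qed.

Lemma transverseP (S : {set point}) :
  transverse groups S <-> {in S &, injective group_index}.
Proof.
split=> [tS x x' xS x'S exx' | inj A /imsetP[u _ ->]].
  have /tS : group_at (group_index x) \in groups by apply: imset_f.
  by move/card_le1_eqP; apply; rewrite !inE ?xS ?x'S ?exx' eqxx.
apply/card_le1_eqP => x x'; rewrite !inE => /andP[xS /eqP xu] /andP[x'S /eqP x'u].
by apply: inj; rewrite // xu.
Qed.

(** A transverse set is the graph of a partial function on [P], with at most one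
    point of [Y] adjoined. *)
Lemma transverse_decomp (S : {set point}) : transverse groups S ->
  exists (f : {ffun P -> Z}) Q, S = graph_on f Q \/ exists y, S = inr y |: graph_on f Q.
Proof.
move/transverseP=> inj.
pose f := [ffun v => odflt 0%R [pick z | inl (v, z) \in S]].
pose Q := [set v | [exists z, inl (v, z) \in S]].
have inS v z : (inl (v, z) \in S) = (v \in Q) && (z == f v).
  apply/idP/andP=> [vzS | [/[!inE]/existsP[z' vz'S] /eqP->]]; rewrite ?inE ffunE.
    split; first by apply/existsP; exists z.
    case: pickP => [z' vz'S | /(_ z)/idP//].
    by have /(_ erefl)[->] := inj _ _ vzS vz'S.
  by case: pickP => [z'' // | /(_ z')/idP].
exists f, Q; case: (pickP [pred y | inr y \in S]) => [y yS | noY].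
  right; exists y; apply/setP=> -[[v z] | y']; rewrite in_setU1.
    by rewrite mem_graph_inl inS.
  rewrite mem_graph_inr orbF; apply/idP/eqP=> [y'S | [->] //].
  by apply: inj.
left; apply/setP=> -[[v z] | y']; rewrite ?mem_graph_inl ?inS // mem_graph_inr.
exact: noY.
Qed.

Lemma subset_graph_on f Q f' Q' :
  graph_on f Q \subset graph_on f' Q' -> Q \subset Q' /\ {in Q, f =1 f'}.
Proof.
move=> /subsetP sub; split=> [|v vQ]; first apply/subsetP => v vQ.
  have := sub (inl (v, f v)); rewrite !mem_graph_inl vQ eqxx.
  by move=> /(_ isT)/andP[].
have := sub (inl (v, f v)); rewrite !mem_graph_inl vQ eqxx.
by move=> /(_ isT)/andP[_ /eqP].
Qed.

Lemma eq_graph_on (f f' : {ffun P -> Z}) (Q : {set P}) :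
  {in Q, f =1 f'} -> graph_on f Q = graph_on f' Q.
Proof. by move=> ff'; apply: eq_in_imset => v vQ; rewrite ff'. Qed.

Lemma graph_sub_block f Q y f' Q' :
  graph_on f Q \subset inr y |: graph_on f' Q' -> graph_on f Q \subset graph_on f' Q'.
Proof.
move/subsetP=> sub; apply/subsetP=> -[[v z] | y'] xS; last by rewrite mem_graph_inr in xS.
by have := sub _ xS; rewrite in_setU1.
Qed.

Variable t : nat.
Hypothesis t_gt0 : 0 < t.
Hypothesis sysP : forall y, steiner t (sys y).
Hypothesis multiplicity :
  forall Q : {set P}, #|Q| = t.+1 -> #|[set y | Q \in sys y]| = #|Z|.
Hypothesis ltZY : #|Z| < #|Y|.

Lemma block_card b : b \in blocks -> #|b| = t.+2.
Proof.
case/blocksP=> y [Q [f [QB _ ->]]].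
by rewrite cardsU1 mem_graph_inr card_graph_on (sysP y).1.
Qed.

Lemma block_transverse b : b \in blocks -> transverse groups b.
Proof.
case/blocksP=> y [Q [f [_ _ ->]]]; apply/transverseP.
move=> [[v z]|y1] [[v' z']|y2]; rewrite !in_setU1 ?mem_graph_inl ?mem_graph_inr ?orbF //=.
  by move=> /andP[_ /eqP->] /andP[_ /eqP->] [->].
by move=> /eqP-> /eqP->.
Qed.

(** Over a given [Q], the map [color Q] takes each value exactly once on
    the systems that contain [Q]; the sum of [f] selects one of them. *)
Lemma cover_colorless f (Q : {set P}) : #|Q| = t.+1 ->
  exists! b, b \in blocks /\ graph_on f Q \subset b.
Proof.
move=> cardQ.
have [y [[]]] := label_bij 0%R (\sum_(v in Q) f v)%R (multiplicity cardQ).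
rewrite inE => QB col uniq_y; exists (inr y |: graph_on f Q); split.
  by split; [apply/blocksP; exists y, Q, f | apply: subsetUr].
move=> b [/blocksP[y' [Q' [f' [Q'B col' ->]]]]].
case/graph_sub_block/subset_graph_on=> QQ' ff'.
have EQ : Q = Q'.
  by apply/eqP; rewrite eqEcard QQ' cardQ ((sysP y').1 _ Q'B) leqnn.
subst Q'; rewrite (eq_graph_on ff') (uniq_y y') //; split; first by rewrite inE.
by rewrite -/(color Q y') col'; apply: eq_bigr => v vQ; rewrite ff'.
Qed.

(** The system [y] supplies the missing place [j], and the sum condition the value
    of [f] at [j]. *)
Lemma cover_colored f (T : {set P}) y : #|T| = t ->
  exists! b, b \in blocks /\ inr y |: graph_on f T \subset b.
Proof.
move=> cardT; have [sizeB /(_ T cardT)[Q [[QB TQ] uniq_Q]]] := sysP y.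
have [j QE] : exists j, Q :\: T = [set j].
  by apply/cards1P; rewrite cardsDS // sizeB // cardT subSnn.
have /setDP[jQ jT] : j \in Q :\: T by rewrite QE set11.
have sumQ (f' : {ffun P -> Z}) :
    (\sum_(v in Q) f' v = f' j + \sum_(v in T) f' v)%R.
  by rewrite (big_setID T) /= (setIidPr TQ) QE big_set1 addrC.
(* [f], with its value at [j] corrected so that the sum over [Q] becomes [color Q y]. *)
pose f1 := [ffun v => if v == j then (color Q y - \sum_(v in T) f v)%R else f v].
have f1T : {in T, f =1 f1}.
  by move=> v vT; rewrite ffunE; case: eqP => // vj; rewrite -vj vT in jT.
exists (inr y |: graph_on f1 Q); split.
  split.
    apply/blocksP; exists y, Q, f1; split=> //; rewrite sumQ ffunE eqxx.
    by rewrite -(eq_bigr _ f1T) subrK.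
  by rewrite (eq_graph_on f1T) setUS // imsetS.
move=> b [/blocksP[y' [Q' [f' [Q'B col' ->]]]] sub].
have /eqP[Ey] : inr y == inr y' :> point.
  by have := subsetP sub (inr y) (setU11 _ _); rewrite in_setU1 mem_graph_inr orbF.
subst y'; have := subset_trans (subsetUr _ _) sub.
case/graph_sub_block/subset_graph_on=> TQ' ff'.
have EQ := uniq_Q _ (conj Q'B TQ'); subst Q'.
congr (_ |: _); apply: eq_graph_on => v vQ.
have [vT | vT] := boolP (v \in T); first by rewrite -f1T // ff'.
have /set1P-> : v \in [set j] by rewrite -QE inE vT.
rewrite ffunE eqxx col' sumQ.
by rewrite (eq_bigr f' ff') addrK.
Qed.

Lemma cover (S : {set point}) : #|S| = t.+1 -> transverse groups S ->
  exists! b, b \in blocks /\ S \subset b.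
Proof.
move=> cardS /transverse_decomp[f [Q [SE | [y SE]]]]; subst S.
  by apply: cover_colorless; rewrite card_graph_on in cardS.
by apply: cover_colored; move: cardS; rewrite cardsU1 mem_graph_inr card_graph_on => -[].
Qed.

Lemma card_group u : #|group_at u| = if u is Some _ then #|Z| else #|Y|.
Proof.
case: u => [v|].
  have inj : injective (fun z : Z => inl (v, z) : point) by move=> z z' [].
  rewrite -cardsT -(card_imset [set: Z] inj); apply: eq_card => x.
  rewrite inE; apply/eqP/imsetP => [|[z _ ->] //].
  by case: x => [[w z]|y] //= [->]; exists z.
have inj : injective (fun y : Y => inr y : point) by move=> y y' [].
rewrite -cardsT -(card_imset [set: Y] inj); apply: eq_card => x.
rewrite inE; apply/eqP/imsetP => [|[y _ ->] //].
by case: x => [[w z]|y] //= _; exists y.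
Qed.

Lemma group_at_neq0 u : group_at u != set0.
Proof.
rewrite -card_gt0 card_group; case: u => [_|]; last exact: leq_trans ltZY.
by apply/card_gt0P; exists 0%R.
Qed.

Lemma group_at_inj : injective group_at.
Proof.
move=> u u' E; have /set0Pn[x xu] := group_at_neq0 u.
have xu' := xu; rewrite E inE in xu'; rewrite inE in xu.
by rewrite -(eqP xu) (eqP xu').
Qed.

Lemma groups_partition : partition groups [set: point].
Proof.
have -> : groups = preim_partition group_index [set: point].
  apply/setP=> A; apply/imsetP/imsetP=> [[u _ ->] | [x _ ->]].
    have /set0Pn[x xu] := group_at_neq0 u; exists x => //.
    by apply/setP=> x'; rewrite !inE /= in xu *; rewrite (eqP xu) eq_sym.
  by exists (group_index x) => //; apply/setP=> x'; rewrite !inE /= eq_sym.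
exact: preim_partitionP.
Qed.

Lemma card_groups_of_size n :
  #|[set A in groups | #|A| == n]|
  = #|[set u : option P | #|group_at u| == n]|.
Proof.
rewrite -(card_imset _ group_at_inj); apply: eq_card => A; rewrite inE.
apply/andP/imsetP => [[/imsetP[u _ ->] un] | [u]].
  by exists u; rewrite ?inE.
by rewrite inE => un ->; rewrite imset_f.
Qed.

(** The inequality keeps the two group sizes distinct, so that the type has two
    entries; it also makes the large group nonempty. *)
Theorem GDD_of_multifold_large_set :
  is_GDD t.+1 t.+2 (#|P| * #|Z| + #|Y|) [:: (#|Z|, #|P|); (#|Y|, 1)]
    groups blocks.
Proof.
have neqZY : (#|Z| == #|Y|) = false by rewrite ltn_eqF.
have neqYZ : (#|Y| == #|Z|) = false by rewrite gtn_eqF.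
have injS : injective (@Some P) by move=> v w [].
split.
- by [].
- by rewrite /= inE neqZY.
- by rewrite !big_cons big_nil /= mul1n addn0.
- by rewrite card_sum card_prod.
- exact: groups_partition.
- rewrite card_imset; last exact: group_at_inj.
  by rewrite card_option !big_cons big_nil /= addn1.
- move=> gn; rewrite !inE => /orP[] /eqP-> /=; rewrite card_groups_of_size.
    rewrite -[RHS]cardsT -[RHS](card_imset _ injS); apply: eq_card => u.
    rewrite inE card_group; apply/idP/imsetP => [|[v _ ->] //].
    by case: u => [v _|]; [exists v | rewrite neqYZ].
  rewrite -(cards1 (@None P)); apply: eq_card => u.
  by rewrite !inE card_group; case: u => [v|]; rewrite ?eqxx // neqZY.
- exact: block_card.
- exact: block_transverse.
- exact: cover.
Qed.

End GroupDivisibleDesign.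

(** * Counting blocks through small sets by nested filters *)

(** Runs [test], for every decreasing sequence [s] of [k] numbers in [lo, n), on
    the list of those items of [L] whose block contains [s].  The lists are
    filtered one element of [s] at a time, so that the work for a common prefix
    is shared; this is what makes the exhaustive checks below cheap. *)
Fixpoint all_filtered (B : Type) (bl : B -> seq nat) (test : pred (seq B))
    (lo k n : nat) (L : seq B) : bool :=
  if k is k'.+1 then
    all (fun a => all_filtered bl test lo k' a [seq b <- L | a \in bl b])
        (iota lo (n - lo))
  else test L.

Lemma all_filteredP (B : Type) (bl : B -> seq nat) (test : pred (seq B))
    lo n (L : seq B) (s : seq nat) :
  all_filtered bl test lo (size s) n L -> path gtn n s -> all (leq lo) s ->
  test [seq b <- L | all [in bl b] s].
Proof.
elim: s n L => [|a s IHs] n L /=.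
  by rewrite (eq_filter (a2 := predT)) // filter_predT.
move=> /allP ok /andP[lt_an path_s] /andP[le_lo le_s].
have a_range : a \in iota lo (n - lo).
  by rewrite mem_iota le_lo subnKC // (leq_trans le_lo) // ltnW.
have := IHs _ _ (ok a a_range) path_s le_s; rewrite -filter_predI.
by congr (test _); apply: eq_filter => b /=; rewrite andbC.
Qed.

(** * Places, motions and their numerical codes *)

Definition place := ('I_17 + 'I_3)%type.
Definition motion := ('I_17 * 'I_3)%type.

(** Computations run on the codes 0, ..., 16 of F_17 and 17, 18, 19 of the extra
    points; a block is given by the list of the codes of its places. *)
Definition code (x : place) : nat :=
  match x with inl u => u | inr e => 17 + e end.

Definition move_by (a : motion) (x : place) : place :=
  match x with inl u => inl (u + a.1)%R | inr e => inr (e + a.2)%R end.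

Definition block (l : seq nat) : {set place} := [set x | code x \in l].

Definition well_formed (l : seq nat) : bool :=
  [&& uniq l, size l == 4 & all (gtn 20) l].

Definition translate (s r n : nat) : nat :=
  if n < 17 then (n + s) %% 17 else 17 + (n - 17 + r) %% 3.

Lemma code_inj : injective code.
Proof.
move=> [u|e] [u'|e'] /= E.
- by congr inl; apply: val_inj.
- by have := ltn_ord u; rewrite E ltnNge leq_addr.
- by have := ltn_ord u'; rewrite -E ltnNge leq_addr.
- by congr inr; apply: val_inj; apply: addnI E.
Qed.

Lemma code_lt x : code x < 20.
Proof.
case: x => [u|e] /=; first exact: leq_trans (ltn_ord u) _.
by rewrite -[20]/(17 + 3) ltn_add2l ltn_ord.
Qed.

Lemma code_onto n : n < 20 -> exists x, code x = n.
Proof.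
move=> lt_n20; have [lt_n17 | le17n] := ltnP n 17.
  by exists (inl (Ordinal lt_n17)).
have lt_n3 : n - 17 < 3 by rewrite ltn_subLR.
by exists (inr (Ordinal lt_n3)) => /=; rewrite subnKC.
Qed.

Lemma subset_block l l' : all (gtn 20) l ->
  (block l \subset block l') = all [in l'] l.
Proof.
move=> /allP lt_l; apply/subsetP/allP => [sub n nl | sub x].
  have [x xn] := code_onto (lt_l n nl); subst n.
  by have := sub x; rewrite !inE => /(_ nl).
by rewrite !inE; apply: sub.
Qed.

Lemma path_gtn_all n s : path gtn n s -> all (gtn n) s.
Proof. by rewrite (path_sortedE (rev_trans ltn_trans)) => /andP[]. Qed.

(** Decreasing lists of codes are the form in which [all_filteredP] quantifies over
    subsets. *)
Lemma block_of_set (T : {set place}) :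
  exists s, [/\ path gtn 20 s, size s = #|T| & T = block s].
Proof.
pose s := sort geq [seq code x | x <- enum T].
have permE : perm_eq s [seq code x | x <- enum T] by rewrite perm_sort.
exists s; split.
- rewrite (path_sortedE (rev_trans ltn_trans)); apply/andP; split.
    rewrite (perm_all _ permE) all_map; apply/allP=> x _; exact: code_lt.
  rewrite gtn_sorted_uniq_geq (perm_uniq permE) map_inj_uniq ?enum_uniq //=.
    by apply: sort_sorted => m n; apply: leq_total.
  exact: code_inj.
- by rewrite (perm_size permE) size_map cardE.
- apply/setP=> x; rewrite inE (perm_mem permE) mem_map ?mem_enum //.
  exact: code_inj.
Qed.

Lemma card_block l : well_formed l -> #|block l| = 4.
Proof.
case/and3P=> uniq_l /eqP size_l lt_l; rewrite -[RHS]size_l cardE -(size_map code).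
apply/perm_size/uniq_perm => //.
  by rewrite map_inj_uniq ?enum_uniq //; apply: code_inj.
move=> n; apply/mapP/idP => [[x] | nl]; first by rewrite mem_enum inE => ? ->.
have [x xn] := code_onto (allP lt_l n nl).
by exists x; rewrite ?mem_enum ?inE ?xn.
Qed.

Lemma code_move (a : motion) x : code (move_by a x) = translate a.1 a.2 (code x).
Proof.
case: x => [u|e] /=; rewrite /translate; first by rewrite ltn_ord.
by rewrite ltnNge leq_addr /= addKn.
Qed.

Lemma block_translate (a : motion) l : all (gtn 20) l ->
  block (map (translate a.1 a.2) l) = move_by a @: block l.
Proof.
move=> /allP lt_l; apply/setP=> x; rewrite inE.
apply/mapP/imsetP => [[n nl xn] | [x' + ->]].
  have [x' x'n] := code_onto (lt_l n nl); exists x'; first by rewrite inE x'n.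
  by apply: code_inj; rewrite code_move x'n.
by rewrite inE; exists (code x'); rewrite ?code_move.
Qed.

Lemma move_byD a b x : move_by a (move_by b x) = move_by (b + a)%R x.
Proof. by case: x => [u|e] /=; rewrite addrA. Qed.

Lemma move_by0 x : move_by 0%R x = x.
Proof. by case: x => [u|e] /=; rewrite addr0. Qed.

Lemma imset_move_byD a b (Q : {set place}) :
  move_by a @: (move_by b @: Q) = move_by (b + a)%R @: Q.
Proof. by rewrite -imset_comp; apply: eq_imset => x /=; rewrite move_byD. Qed.

Lemma imset_move_by0 (Q : {set place}) : move_by 0%R @: Q = Q.
Proof. by rewrite (eq_imset _ move_by0) imset_id. Qed.

Lemma move_by_inj a : injective (move_by a).
Proof.
by apply: (can_inj (g := move_by (- a)%R)) => x; rewrite move_byD subrr move_by0.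
Qed.

(** * Three base systems *)

(** The common automorphism x -> 2x of the base systems, which fixes the extra
    points; 2 has order 8 modulo 17. *)
Definition dilate (n : nat) : nat := if n < 17 then n.*2 %% 17 else n.

Definition starters0 : seq (seq nat) :=
  [:: [:: 0; 1; 2; 8]; [:: 0; 1; 3; 11]; [:: 0; 1; 5; 18]; [:: 0; 1; 6; 10];
   [:: 0; 1; 7; 14]; [:: 0; 1; 12; 19]; [:: 0; 1; 16; 17]; [:: 0; 3; 14; 17];
   [:: 0; 17; 18; 19]; [:: 1; 2; 3; 6]; [:: 1; 2; 4; 15]; [:: 1; 2; 5; 11];
   [:: 1; 2; 7; 10]; [:: 1; 2; 12; 18]; [:: 1; 2; 13; 17]; [:: 1; 2; 14; 19];
   [:: 1; 3; 4; 12]; [:: 1; 3; 7; 17]; [:: 1; 3; 8; 19]; [:: 1; 3; 14; 16];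
   [:: 1; 3; 15; 18]; [:: 1; 4; 5; 14]; [:: 1; 4; 6; 19]; [:: 1; 4; 7; 11];
   [:: 1; 4; 10; 18]; [:: 1; 4; 13; 16]; [:: 1; 5; 6; 8]; [:: 1; 5; 10; 16];
   [:: 1; 5; 17; 19]; [:: 1; 6; 11; 16]; [:: 1; 6; 12; 17];
   [:: 1; 6; 14; 15]; [:: 1; 8; 11; 12]; [:: 1; 10; 11; 17];
   [:: 1; 14; 17; 18]; [:: 1; 16; 18; 19]; [:: 3; 5; 6; 19];
   [:: 3; 5; 7; 10]; [:: 3; 5; 11; 18]; [:: 3; 5; 12; 14]; [:: 3; 14; 18; 19]].

Definition starters1 : seq (seq nat) :=
  [:: [:: 0; 1; 2; 14]; [:: 0; 1; 3; 13]; [:: 0; 1; 5; 15];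
   [:: 0; 1; 10; 18]; [:: 0; 1; 11; 19]; [:: 0; 1; 16; 17]; [:: 0; 3; 5; 6];
   [:: 0; 3; 14; 17]; [:: 0; 17; 18; 19]; [:: 1; 2; 3; 6]; [:: 1; 2; 4; 15];
   [:: 1; 2; 5; 10]; [:: 1; 2; 7; 19]; [:: 1; 2; 8; 17]; [:: 1; 2; 11; 12];
   [:: 1; 2; 13; 18]; [:: 1; 3; 4; 19]; [:: 1; 3; 5; 17]; [:: 1; 3; 7; 8];
   [:: 1; 3; 12; 18]; [:: 1; 3; 14; 16]; [:: 1; 4; 5; 14]; [:: 1; 4; 6; 7];
   [:: 1; 4; 10; 11]; [:: 1; 4; 13; 16]; [:: 1; 5; 6; 18]; [:: 1; 5; 7; 16];
   [:: 1; 5; 8; 12]; [:: 1; 6; 11; 16]; [:: 1; 6; 12; 15]; [:: 1; 6; 17; 19];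
   [:: 1; 7; 12; 17]; [:: 1; 7; 14; 18]; [:: 1; 8; 10; 19];
   [:: 1; 10; 14; 17]; [:: 1; 11; 17; 18]; [:: 1; 16; 18; 19];
   [:: 3; 5; 7; 10]; [:: 3; 5; 11; 19]; [:: 3; 5; 12; 14]; [:: 3; 14; 18; 19]].

Definition starters2 : seq (seq nat) :=
  [:: [:: 0; 1; 2; 10]; [:: 0; 1; 3; 8]; [:: 0; 1; 4; 14]; [:: 0; 1; 6; 19];
   [:: 0; 1; 7; 18]; [:: 0; 1; 16; 17]; [:: 0; 3; 5; 11]; [:: 0; 3; 14; 17];
   [:: 0; 17; 18; 19]; [:: 1; 2; 3; 11]; [:: 1; 2; 4; 12]; [:: 1; 2; 5; 7];
   [:: 1; 2; 8; 19]; [:: 1; 2; 13; 18]; [:: 1; 2; 14; 17]; [:: 1; 2; 15; 16];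
   [:: 1; 3; 4; 17]; [:: 1; 3; 5; 18]; [:: 1; 3; 6; 12]; [:: 1; 3; 7; 19];
   [:: 1; 3; 10; 15]; [:: 1; 3; 14; 16]; [:: 1; 4; 5; 15]; [:: 1; 4; 6; 10];
   [:: 1; 4; 7; 11]; [:: 1; 4; 13; 16]; [:: 1; 5; 6; 14]; [:: 1; 5; 8; 10];
   [:: 1; 5; 11; 19]; [:: 1; 5; 12; 16]; [:: 1; 6; 11; 16];
   [:: 1; 6; 17; 18]; [:: 1; 7; 10; 16]; [:: 1; 8; 11; 17];
   [:: 1; 10; 12; 18]; [:: 1; 10; 17; 19]; [:: 1; 11; 14; 18];
   [:: 1; 12; 14; 19]; [:: 1; 16; 18; 19]; [:: 3; 5; 6; 17];
   [:: 3; 5; 12; 14]; [:: 3; 6; 11; 14]; [:: 3; 14; 18; 19]].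


(** All images of the starters under the powers of [dilate].  Sorting makes equal
    blocks equal as lists, so that [undup] removes the repetitions coming from
    starters with a nontrivial stabilizer. *)
Definition base (i : nat) : seq (seq nat) :=
  undup [seq sort leq m | l <- nth [::] [:: starters0; starters1; starters2] i,
                          m <- traject (map dilate) l 8].

(** The blocks of all 153 systems, each with the index (i, s, r) of its system:
    base system [i] moved by [(s, r)]. *)
Definition system_blocks : seq ((nat * nat * nat) * seq nat) :=
  [seq (k, map (translate k.1.2 k.2) l)
     | k <- [seq (ij, r) | ij <- [seq (i, s) | i <- iota 0 3, s <- iota 0 17],
                           r <- iota 0 3],
       l <- base k.1.1].

Definition base_check (i : nat) : bool :=
  all well_formed (base i) &&
  all_filtered id (fun L => size L == 1) 0 3 20 (base i).

(** For each 4-set containing the code 0, hence the origin of F_17: exactly nine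
    blocks contain it, and they belong to different systems. *)
Definition multiplicity_check : bool :=
  all_filtered snd (fun L => (size L == 9) && uniq (map fst L)) 1 3 20
    [seq p <- system_blocks | 0 \in p.2].

Lemma base_check_true : all base_check (iota 0 3).
Proof. by vm_compute. Qed.

Lemma multiplicity_check_true : multiplicity_check.
Proof. by vm_compute. Qed.

(** * The 153 systems *)

Definition base_system (i : nat) : {set {set place}} :=
  [set Q | has (fun l => Q == block l) (base i)].

Definition system (y : 'I_3 * motion) : {set {set place}} :=
  [set Q : {set place} | move_by (- y.2)%R @: Q \in base_system y.1].

Lemma base_systemP i Q :
  reflect (exists2 l, l \in base i & Q = block l) (Q \in base_system i).
Proof.
rewrite inE; apply: (iffP hasP) => -[l l_base].
  by move/eqP; exists l.
by move->; exists l.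
Qed.

Lemma base_well_formed i l : i < 3 -> l \in base i -> well_formed l.
Proof.
move=> lt_i3; have /(allP base_check_true)/andP[/allP wf _] : i \in iota 0 3.
  by rewrite mem_iota.
exact: wf.
Qed.

(** The check says that the list of blocks containing a given triple has length
    one, which is existence and uniqueness at once. *)
Lemma steiner_base_system i : i < 3 -> steiner 3 (base_system i).
Proof.
move=> lt_i3; split=> [Q /base_systemP[l l_base ->] | T cardT].
  by rewrite card_block // (base_well_formed lt_i3).
have [s [path_s size_s ->]] := block_of_set T.
have lt_s := path_gtn_all path_s.
have /(allP base_check_true)/andP[_] : i \in iota 0 3 by rewrite mem_iota.
have size3 : size s = 3 by rewrite size_s.
rewrite -[X in all_filtered _ _ _ X]size3 => /all_filteredP/(_ path_s).
have -> : all (leq 0) s by apply/allP.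
move/(_ isT); case E: [seq _ <- _ | _] => [|l []] // _.
have inE' l' : (l' \in base i) && (block s \subset block l') = (l' == l).
  by rewrite subset_block // andbC -mem_seq1 -E mem_filter.
have /andP[l_base sub_sl] : (l \in base i) && (block s \subset block l) by rewrite inE'.
exists (block l); split; first by split=> //; apply/base_systemP; exists l.
move=> Q [/base_systemP[l' l'_base ->] sub_sl'].
by have /eqP-> : l' == l by rewrite -inE' l'_base.
Qed.

Lemma steiner_system y : steiner 3 (system y).
Proof.
have [sizeB uniB] := steiner_base_system (ltn_ord y.1).
split=> [Q | T cardT].
  by rewrite inE => /sizeB; rewrite card_imset //; apply: move_by_inj.
have cardT' : #|move_by (- y.2)%R @: T| = 3.
  by rewrite card_imset //; apply: move_by_inj.
have [Q [[QB TQ] uniq_Q]] := uniB _ cardT'.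
exists (move_by y.2 @: Q); split.
  split; first by rewrite inE imset_move_byD subrr imset_move_by0.
  by have := imsetS (move_by y.2) TQ; rewrite imset_move_byD addNr imset_move_by0.
move=> Q'; rewrite inE => -[Q'B TQ'].
rewrite (uniq_Q _ (conj Q'B (imsetS _ TQ'))).
by rewrite imset_move_byD addNr imset_move_by0.
Qed.

Lemma system_move a i b (Q : {set place}) :
  (move_by a @: Q \in system (i, b)) = (Q \in system (i, b - a)%R).
Proof. by rewrite !inE /= imset_move_byD opprB. Qed.

(** A motion permutes the 51 images of each base system. *)
Lemma multiplicity_move a (Q : {set place}) :
  #|[set y | move_by a @: Q \in system y]| = #|[set y | Q \in system y]|.
Proof.
pose s (y : 'I_3 * motion) := (y.1, (y.2 - a)%R).
have inj_s : injective s.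
  by apply: (can_inj (g := fun y => (y.1, (y.2 + a)%R))) => -[i b]; rewrite /= subrK.
rewrite -(card_imset _ inj_s); apply: eq_card => -[i b].
rewrite inE; apply/imsetP/idP => [[[j c]] | QB].
  by rewrite inE system_move => QB [-> ->].
exists (i, (b + a)%R); last by rewrite /s addrK.
by rewrite inE system_move addrK.
Qed.

(** The numerical index under which a system appears in [system_blocks]. *)
Definition key (y : 'I_3 * motion) : nat * nat * nat :=
  (val y.1, val y.2.1, val y.2.2).

Lemma key_inj : injective key.
Proof.
by move=> [i [s r]] [i' [s' r']] [/val_inj-> /val_inj-> /val_inj->].
Qed.

Lemma mem_system_blocks k l :
  reflect (exists2 y, k = key y & exists2 m, m \in base y.1 &
             l = map (translate y.2.1 y.2.2) m)
          ((k, l) \in system_blocks).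
Proof.
apply: (iffP allpairsPdep).
  case=> k' [m [/allpairsP[[ij r] [ij_in r_in ->]] m_base [-> ->]]].
  case: ij ij_in r_in m_base => i s /allpairsP[[i' s'] [+ + [-> ->]]].
  rewrite !mem_iota => lt_i lt_s lt_r m_base.
  by exists (Ordinal lt_i, (Ordinal lt_s, Ordinal lt_r)); last exists m.
case=> y -> [m m_base ->]; exists (key y), m; split=> //.
apply/allpairsP; exists ((val y.1, val y.2.1), val y.2.2); split=> //.
  by apply/allpairsP; exists (val y.1, val y.2.1); split; rewrite ?mem_iota ?ltn_ord.
by rewrite mem_iota ltn_ord.
Qed.

(** The content of [multiplicity_check] for the 4-set with codes [0 :: s]. *)
Lemma blocks_through_origin s :
  path gtn 20 s -> all (leq 1) s -> size s = 3 ->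
  exists L : seq ((nat * nat * nat) * seq nat),
    [/\ size L = 9, uniq (map fst L) &
        forall p, (p \in L) = (p \in system_blocks) && all [in p.2] (0 :: s)].
Proof.
move=> path_s ge1_s size_s; have := multiplicity_check_true.
rewrite /multiplicity_check -[X in all_filtered _ _ _ X]size_s.
(* The long list is generalized, lest unification try to compute it. *)
move: system_blocks => F /all_filteredP/(_ path_s ge1_s).
set L := filter _ _ => /andP[/eqP sizeL uniqL]; exists L; split=> [||p].
- exact: sizeL.
- exact: uniqL.
rewrite !mem_filter; case: (p \in F); last by rewrite !andbF.
by rewrite andbT andbC.
Qed.

Lemma systemP (y : 'I_3 * motion) (Q : {set place}) :
  reflect (exists2 m, m \in base y.1 & Q = block (map (translate y.2.1 y.2.2) m))
          (Q \in system y).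
Proof.
have blockE m : m \in base y.1 ->
    block (map (translate y.2.1 y.2.2) m) = move_by y.2 @: block m.
  move=> /(base_well_formed (ltn_ord _))/and3P[_ _ lt_m].
  exact: block_translate.
rewrite inE; apply: (iffP (base_systemP _ _)) => -[m m_base QE]; exists m => //.
  by rewrite blockE // -QE imset_move_byD addNr imset_move_by0.
by rewrite QE blockE // imset_move_byD subrr imset_move_by0.
Qed.

(** A block of a system contains [Q] only if it equals [Q], both having four
    elements; so the blocks counted by the check, with pairwise different
    indices, are in bijection with the systems that have [Q] as a block. *)
Lemma multiplicity_at_origin (Q : {set place}) :
  #|Q| = 4 -> inl 0%R \in Q -> #|[set y | Q \in system y]| = 9.
Proof.
move=> cardQ Q0.
have [s [path_s size_s TE]] := block_of_set (Q :\ inl 0%R).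
have QE : Q = block (0 :: s).
  by rewrite -(setD1K Q0) TE; apply/setP=> x; rewrite !inE -(inj_eq code_inj).
have lt_s := path_gtn_all path_s.
have ge1_s : all (leq 1) s.
  apply/allP=> n ns; have [x xn] := code_onto (allP lt_s n ns); subst n.
  have : x \in Q :\ inl 0%R by rewrite TE inE.
  by rewrite !inE -(inj_eq code_inj) lt0n => /andP[].
have size_s3 : size s = 3.
  by move: cardQ; rewrite (cardsD1 (inl 0%R)) Q0 -size_s => -[].
have [L [sizeL uniqL memL]] := blocks_through_origin path_s ge1_s size_s3.
have all_sE l : all [in l] (0 :: s) = (Q \subset block l).
  by rewrite QE subset_block.
rewrite -[RHS]sizeL -(size_map fst) cardE -(size_map key).
apply/perm_size/uniq_perm.
- by rewrite map_inj_uniq ?enum_uniq //; apply: key_inj.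
- exact: uniqL.
move=> k; apply/mapP/mapP => [[y yQ ->] | [[k' l] + ->]].
  move: yQ; rewrite mem_enum inE => /systemP[m m_base QmE].
  exists (key y, map (translate y.2.1 y.2.2) m); last by [].
  rewrite memL all_sE -QmE subxx andbT.
  by apply/mem_system_blocks; exists y; last exists m.
rewrite memL all_sE => /andP[/mem_system_blocks[y -> [m m_base ->]] sub].
exists y; last by [].
rewrite mem_enum inE; apply/systemP; exists m; first exact: m_base.
apply/eqP; rewrite eqEcard sub cardQ leq_eqVlt; apply/orP; left; apply/eqP.
apply: (steiner_system y).1; apply/systemP; exists m => //.
Qed.

(** There are only three extra points, so a 4-set has a place in F_17, which some
    translation takes to the origin. *)
Lemma multiplicity_system (Q : {set place}) :
  #|Q| = 4 -> #|[set y | Q \in system y]| = 9.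
Proof.
move=> cardQ; have [u uQ] : exists u, inl u \in Q.
  apply/existsP; apply: contraTT isT => /existsPn noU.
  have : #|Q| <= #|[set (inr e : place) | e in 'I_3]|.
    apply/subset_leq_card/subsetP => -[u | e] xQ; last exact: imset_f.
    by have := noU u; rewrite xQ.
  by rewrite cardQ card_imset ?card_ord // => e e' [].
rewrite -(multiplicity_move (- u, 0)%R); apply: multiplicity_at_origin.
  by rewrite card_imset //; apply: move_by_inj.
by apply/imsetP; exists (inl u); rewrite //= subrr.
Qed.

(** * The group divisible design *)

Theorem corollary10 (h : nat) (hh : 1 <= h) :
  GDD_exists 4 5 (20 * (9 * h) + 17 * (9 * h))
    [:: (9 * h, 20); (17 * (9 * h), 1)].
Proof.
case: h hh => // h _.
(* The modulus is written as a successor, to make 'I_(9 * h.+1) an additive group. *)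
pose Z : finZmodType := 'I_(9 * h.+1).-1.+1.
(* The second component indexes the copies of each system. *)
pose Y : finType := (('I_3 * motion) * 'I_h.+1)%type.
pose sys (y : Y) := system y.1.
have cardZ : #|Z| = 9 * h.+1 by rewrite card_ord mulnS.
have cardY : #|Y| = 17 * (9 * h.+1).
  by rewrite !card_prod !card_ord [RHS]mulnA.
have cardP : #|{: place}| = 20 by rewrite card_sum !card_ord.
exists (place * Z + Y)%type, (groups place Y Z), (@blocks place Y Z sys).
have steinerY y : steiner 3 (sys y) by apply: steiner_system.
have mult (Q : {set place}) :
    #|Q| = 4 -> #|[set y | Q \in sys y]| = #|Z|.
  move=> cardQ; rewrite cardZ.
  have -> : [set y | Q \in sys y] = setX [set y | Q \in system y] [set: 'I_h.+1].
    by apply/setP=> y; rewrite !inE andbT.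
  by rewrite cardsX multiplicity_system // cardsT card_ord.
have ltZY : #|Z| < #|Y| by rewrite cardY cardZ ltn_Pmull.
have := GDD_of_multifold_large_set (isT : 0 < 3) steinerY mult ltZY.
by rewrite cardP cardZ cardY.
Qed.
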